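(* For every $\varepsilon\in(0,\tfrac12)$ and every $d\in\mathbb{N}=\{1,2,\dots\}$, the information complexity of integration for the class $F_d^{\,\mathrm{mon}}$ of monotone functions satisfies $$n^{\mathrm{int}}(F_d^{\,\mathrm{mon}},\varepsilon)\ \ge\ 2^d\,(1-2\varepsilon).$$ Thus, the integration problem for monotone functions suffers from the curse of dimensionality.
   Context: For $d\in\mathbb{N}$, let $F_d^{\,\mathrm{mon}}$ be the set of all functions $f:[0,1]^d\to[0,1]$ that are monotone, i.e. non-decreasing in each variable $x_j$ when the other variables are fixed. Let $\mathrm{INT}_d(f)=\int_{[0,1]^d}f(x)\,dx$. For an integer $n\ge 0$, an algorithm $A_n$ using $n$ function values has the form $A_n(f)=\phi_n(f(t_1),\dots,f(t_n))$, where $\phi_n:\mathbb{R}^n\to\mathbb{R}$ is an arbitrary mapping and the sample points $t_j\in[0,1]^d$ are arbitrary and may be chosen adaptively: $t_1$ is fixed and, for $j\ge2$, $t_j$ may depend (arbitrarily) on the already computed values $f(t_1),\dots,f(t_{j-1})$. For $n=0$, $A_0$ is a constant real number. For a class $F_d$ of such functions, the $n$th minimal worst case error is $$e_n^{\mathrm{int}}(F_d)=\inf_{A_n}\ \sup_{f\in F_d}|\mathrm{INT}_d(f)-A_n(f)|,$$ where the infimum is over all algorithms $A_n$ of the form $A_n(f)=\phi_n(f(t_1),\dots,f(t_n))$ with arbitrary $\phi_n:\mathbb{R}^n\to\mathbb{R}$ and arbitrary, possibly adaptively chosen, sample points $t_j\in[0,1]^d$ (over all real constants $A_0$ if $n=0$),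 and the information complexity is $$n^{\mathrm{int}}(F_d,\varepsilon)=\min\{n\in\{0,1,2,\dots\}: e_n^{\mathrm{int}}(F_d)\le\varepsilon\}.$$ The problem suffers from the curse of dimensionality if its information complexity is at least exponential in $d$ for some fixed $\varepsilon$, i.e. there exist $\varepsilon>0$, $c>0$ and $\gamma>1$ such that the information complexity at $\varepsilon$ is at least $c\,\gamma^d$ for all $d\in\mathbb{N}$. *)

(* Defs.v *)
From HB Require Import structures.
From mathcomp Require Import all_boot all_order all_algebra.
From mathcomp Require Import all_classical all_reals all_analysis.

Set Implicit Arguments.
Unset Strict Implicit.
Unset Printing Implicit Defensive.

Import Order.TTheory GRing.Theory Num.Theory.
Import numFieldNormedType.Exports.

Local Open Scope classical_set_scope.
Local Open Scope ring_scope.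

(* R^d as d-tuples, with the product of the Borel sigma-algebras of R. *)
Notation euclid R d := (d.-tuple (measurableTypeR R)).

Section lebesgue_cons.
Context {R : realType} (d : nat).
Variable mu : {sigma_finite_measure set (euclid R d) -> \bar R}.

Definition tuple_cons (p : measurableTypeR R * euclid R d) : euclid R d.+1 :=
  [tuple of p.1 :: p.2].

Definition lebesgue_cons : set (euclid R d.+1) -> \bar R :=
  pushforward (@lebesgue_measure R \x mu)%E tuple_cons.

Lemma measurable_tuple_cons : measurable_fun setT tuple_cons.
Proof. exact: measurable_cons. Qed.

Let lebesgue_cons0 : lebesgue_cons set0 = 0%E.
Proof. by rewrite /lebesgue_cons /pushforward preimage_set0 measure0. Qed.

Let lebesgue_cons_ge0 A : (0 <= lebesgue_cons A)%E.
Proof. by rewrite /lebesgue_cons /pushforward; exact: measure_ge0. Qed.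

Let lebesgue_cons_sigma_additive : semi_sigma_additive lebesgue_cons.
Proof.
move=> F mF tF mUF; rewrite /lebesgue_cons /pushforward preimage_bigcup.
have mc (A : set (euclid R d.+1)) : measurable A ->
    measurable (tuple_cons @^-1` A).
  by move=> mA; rewrite -[X in measurable X]setTI; exact: measurable_tuple_cons.
apply: measure_semi_sigma_additive.
- by move=> n; exact: mc.
- apply/trivIsetP => /= i j _ _ ij; rewrite -preimage_setI.
  by move/trivIsetP : tF => /(_ _ _ _ _ ij) ->//; rewrite preimage_set0.
- by rewrite -preimage_bigcup; exact: mc.
Qed.

HB.instance Definition _ := isMeasure.Build _ _ _ lebesgue_cons
  lebesgue_cons0 lebesgue_cons_ge0 lebesgue_cons_sigma_additive.

Let lebesgue_cons_sigma_finite : sigma_finite setT lebesgue_cons.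
Proof.
have [F [FT ndF Ffin]] := (sigma_finiteP _ _).1 (sigma_finiteT (@lebesgue_measure R)).
have [G [GT ndG Gfin]] := (sigma_finiteP _ _).1 (sigma_finiteT mu).
pose split (x : euclid R d.+1) := (thead x, [tuple of behead x] : euclid R d).
have consK p : split (tuple_cons p) = p.
  by case: p => a b; congr (_, _); exact/val_inj.
have msplit : measurable_fun setT split.
  apply/measurable_fun_pair => //=; first exact: measurable_tnth.
  exact: measurable_behead.
exists (fun n => split @^-1` (F n `*` G n)).
  apply/seteqP; split => // x _.
  have [i _ Fi] : (\bigcup_n F n) (split x).1 by rewrite -FT.
  have [j _ Gj] : (\bigcup_n G n) (split x).2 by rewrite -GT.
  exists (maxn i j) => //; split.
  - by move: Fi; exact/subsetPset/ndF/leq_maxl.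
  - by move: Gj; exact/subsetPset/ndG/leq_maxr.
move=> n; have [mF Foo] := Ffin n; have [mG Goo] := Gfin n; split.
  by rewrite -[X in measurable X]setTI; apply: msplit => //; exact: measurableX.
rewrite /lebesgue_cons /pushforward -comp_preimage.
have -> : split \o tuple_cons = id by apply/funext => p /=; exact: consK.
by rewrite preimage_id product_measure1E// lte_mul_pinfty// ge0_fin_numE.
Qed.

HB.instance Definition _ := Measure_isSigmaFinite.Build _ _ _ lebesgue_cons
  lebesgue_cons_sigma_finite.

End lebesgue_cons.

(* d-dimensional Lebesgue measure, as the iterated product of the
   one-dimensional one; see [lebesgue_euclid_box]. *)
Fixpoint lebesgue_euclid (R : realType) (d : nat) :
    {sigma_finite_measure set (euclid R d) -> \bar R} :=
  if d is d'.+1 then lebesgue_cons (lebesgue_euclid R d')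
  else \d_([tuple] : euclid R 0).

Lemma lebesgue_euclid_box (R : realType) (d : nat) (A : 'I_d -> set R) :
  (forall i, measurable (A i : set (measurableTypeR R))) ->
  lebesgue_euclid R d [set x | forall i, A i (tnth x i)] =
  (\prod_(i < d) lebesgue_measure (A i))%E.
Proof.
elim: d A => [|d IH] A mA.
  rewrite big_ord0 /= diracE mem_set //=; by case.
rewrite big_ord_recl /= -(IH (A \o lift ord0)) => [|i]; last exact: mA.
rewrite /lebesgue_cons /pushforward -product_measure1E //; last first.
  rewrite (_ : [set x | _] =
      \big[setI/setT]_(i < d) ((@tnth d R ^~ i) @^-1` A (lift ord0 i))).
    apply: bigsetI_measurable => i _; rewrite -[X in measurable X]setTI.
    exact: (@measurable_tnth _ (measurableTypeR R)).
  apply/seteqP; split => [x xA|x].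
    by rewrite -bigcap_seq => i _; exact: xA.
  by rewrite -bigcap_seq => xA i; apply: xA => /=; rewrite mem_index_enum.
congr (product_measure1 _ _ _); apply/seteqP; split => -[a b] /=.
  move=> h; split; first exact: (h ord0).
  by move=> i /=; have := h (lift ord0 i); rewrite /tuple_cons tnthS.
move=> [h0 h] i; have [->//|i0] := eqVneq i ord0.
have [j ->] : exists j, i = lift ord0 j.
  by case: (unliftP ord0 i) i0 => [j ->|->]; [exists j|rewrite eqxx].
by rewrite /tuple_cons tnthS; exact: h.
Qed.

Section integration_problem.
Context {R : realType}.

Definition unit_cube (d : nat) : set (euclid R d) :=
  [set x | forall i, tnth x i \in `[0, 1]].

(* A function on [0,1]^d is represented by a total function on R^d whose values
   off the cube are irrelevant: neither the integral nor the algorithms below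
   depend on them. *)
Definition monotone_class (d : nat) : set (euclid R d -> R) :=
  [set f | (forall x, unit_cube x -> f x \in `[0, 1]) /\
           (forall (j : 'I_d) x y, unit_cube x -> unit_cube y ->
              (forall k, k != j -> tnth x k = tnth y k) ->
              tnth x j <= tnth y j -> f x <= f y)].

(* A monotone function on the cube is Lebesgue, but not necessarily Borel,
   measurable. For a nonnegative integrand the integral of the library is the
   supremum of the integrals of the Borel simple functions below it, which
   agrees with the Lebesgue integral for every Lebesgue measurable integrand. *)
Definition INT (d : nat) (f : euclid R d -> R) : R :=
  Rintegral (lebesgue_euclid R d) (@unit_cube d) f.

(* [alg_node A j v] is the sample point t_(j+1), chosen from the j values v
   already computed; only the nodes with j < n are used. *)
Record algorithm (d n : nat) := Algorithm {
  alg_node : forall j : nat, j.-tuple R -> euclid R d ;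
  alg_node_cube : forall (j : nat) (v : j.-tuple R), unit_cube (alg_node v) ;
  alg_phi : n.-tuple R -> R }.

Fixpoint alg_info (d n : nat) (A : algorithm d n) (f : euclid R d -> R)
    (j : nat) : j.-tuple R :=
  if j is k.+1 then
    let v := alg_info A f k in [tuple of rcons v (f (alg_node A v))]
  else [tuple].

Definition alg_apply (d n : nat) (A : algorithm d n) (f : euclid R d -> R) : R :=
  alg_phi A (alg_info A f n).

Definition worst_case_error (d n : nat) (F : set (euclid R d -> R))
    (A : algorithm d n) : \bar R :=
  ereal_sup [set (`|INT f - alg_apply A f|)%:E | f in F].

Definition min_error (n d : nat) (F : set (euclid R d -> R)) : \bar R :=
  ereal_inf [set worst_case_error F A | A in [set: algorithm d n]].

(* The infimum of a nonempty set of natural numbers is its minimum; the value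
   is +oo when no n achieves error at most e. *)
Definition info_complexity (d : nat) (F : set (euclid R d -> R)) (e : R) :
    \bar R :=
  ereal_inf [set n%:R%:E | n in [set n | (min_error n F <= e%:E)%E]].

Definition curse_of_dimensionality
    (F : forall d : nat, set (euclid R d -> R)) : Prop :=
  exists e c g : R, [/\ 0 < e, 0 < c, 1 < g &
    forall d : nat, (0 < d)%N ->
      ((c * g ^+ d)%:E <= info_complexity (F d) e)%E].

End integration_problem.

Arguments unit_cube : clear implicits.
Arguments monotone_class : clear implicits.

(* Main.v *)
Require Import Defs.
From HB Require Import structures.
From mathcomp Require Import all_boot all_order all_algebra.
From mathcomp Require Import all_classical all_reals all_analysis.
From mathcomp Require Import lra.

(** A fooling argument. Run the algorithm on the indicator of the upper half
    [sum x_i >= d/2] of the cube: every answer it gets is 0 or 1, and this fixes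
    the nodes [t_0, ..., t_(n-1)], adaptive or not. An answer 1 at [t] only
    forces a monotone function to equal 1 on the box of points above [t], and an
    answer 0 only forces it to vanish on the box of points below [t]. By AM-GM
    each such box has volume at most [2^-d] ([measure_decided_set]): a node
    with sum at least [d/2] is too high for the box above it to be large, and a
    node with a smaller sum is too low for the box below it to be large.

    The smallest and the largest monotone 0/1 functions with these answers
    differ on the whole cube outside the [n] boxes, so their integrals differ by
    at least [1 - n 2^-d] ([fooling_gap]). The algorithm takes the same nodes
    and returns the same value on both ([alg_info_eq]), so it errs by at least
    half of that gap on one of them ([worst_case_error_ge]). An error of at most
    [e] therefore requires [n >= 2^d (1 - 2 e)]; the curse of dimensionality is
    the case [e = 1/4]. *)

Import Order.TTheory GRing.Theory Num.Theory.
Import numFieldNormedType.Exports.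

Local Open Scope classical_set_scope.
Local Open Scope ring_scope.

Section Fooling.
Set Implicit Arguments.
Unset Strict Implicit.
Context {R : realType} {d : nat}.
Implicit Types (x y t : euclid R d) (A E : set (euclid R d)) (n k : nat).

Let mu := lebesgue_euclid R d.
Let cube : set (euclid R d) := unit_cube R d.

(** * Boxes decided by a node *)

Definition tuple_le x y : Prop := forall i, tnth x i <= tnth y i.

Definition up_set t : set (euclid R d) := [set x | tuple_le t x].
Definition down_set t : set (euclid R d) := [set x | tuple_le x t].

Definition upper_half x : bool := d%:R / 2 <= \sum_(i < d) tnth x i.

(** The part of the cube on which a monotone 0/1 function is determined by
    taking, at [t], the value of the indicator of the upper half. *)
Definition decided_set t : set (euclid R d) :=
  cube `&` (if upper_half t then up_set t else down_set t).

Lemma upper_half_le x y : tuple_le x y -> upper_half x -> upper_half y.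
Proof. by move=> xy /le_trans; apply; apply: ler_sum => i _; exact: xy. Qed.

(** * Volumes of the decided boxes *)

Lemma measurable_product (I : 'I_d -> set R) :
  (forall i, measurable (I i : set (measurableTypeR R))) ->
  measurable ([set x | forall i, I i (tnth x i)] : set (euclid R d)).
Proof.
move=> mI; rewrite (_ : [set x | _] =
    \bigcap_(i in [set` index_enum 'I_d]) ((fun x => tnth x i) @^-1` I i)).
  rewrite bigcap_seq; apply: bigsetI_measurable => i _.
  rewrite -[X in measurable X]setTI.
  exact: (@measurable_tnth _ (measurableTypeR R)).
apply/seteqP; split=> x /= xI i; first by move=> _; exact: xI.
by apply: xI => /=; rewrite mem_index_enum.
Qed.

Lemma measurable_cube : measurable cube.
Proof.
apply: (@measurable_product (fun=> `[0, 1]%classic)) => i; exact: measurable_itv.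
Qed.

Lemma measurable_up_set t : measurable (up_set t).
Proof.
rewrite (_ : up_set t = [set x | forall i, `[tnth t i, +oo[%classic (tnth x i)]).
  apply: (@measurable_product (fun i => `[tnth t i, +oo[%classic)) => i.
  exact: measurable_itv.
by apply/seteqP; split=> x /= xt i; move: (xt i); rewrite /= in_itv/= andbT.
Qed.

Lemma measurable_down_set t : measurable (down_set t).
Proof.
rewrite (_ : down_set t = [set x | forall i, `]-oo, tnth t i]%classic (tnth x i)]).
  apply: (@measurable_product (fun i => `]-oo, tnth t i]%classic)) => i.
  exact: measurable_itv.
by apply/seteqP; split=> x /= xt i; move: (xt i); rewrite /= in_itv.
Qed.

Lemma measurable_decided_set t : measurable (decided_set t).
Proof.
apply: measurableI; first exact: measurable_cube.
case: ifP => _; [exact: measurable_up_set | exact: measurable_down_set].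
Qed.

Lemma measure_box (a b : 'I_d -> R) : (forall i, a i <= b i) ->
  mu [set x | forall i, tnth x i \in `[a i, b i]] =
  (\prod_(i < d) (b i - a i))%:E.
Proof.
move=> ab; rewrite /mu (lebesgue_euclid_box (A := fun i => [set` `[a i, b i]])).
  rewrite -prodEFin; apply: eq_bigr => i _.
  rewrite lebesgue_measure_itv /= lte_fin EFinB.
  by case: ltgtP (ab i) => // -> _; rewrite subee.
by move=> i; exact: measurable_itv.
Qed.

Lemma measure_cube : mu cube = 1%E.
Proof.
rewrite [LHS](@measure_box (fun=> 0) (fun=> 1)) //.
by rewrite big1 // => i _; rewrite subr0.
Qed.

(** AM-GM: the factors have mean at most 1/2. *)
Lemma prod_le_half (u : 'I_d -> R) : (forall i, 0 <= u i) ->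
  \sum_(i < d) u i <= d%:R / 2 -> \prod_(i < d) u i <= 2^-1 ^+ d.
Proof.
move=> u0 usum.
have [] := @leif_AGM R 'I_d predT u (fun i _ => u0 i).
rewrite cardT size_enum_ord => /le_trans + _; apply.
(* In dimension 0 the mean is 0 / 0 = 0, and both products are empty. *)
have avg : (\sum_i u i) / d%:R <= 2^-1.
  have [->|d0] := eqVneq (d%:R : R) 0; first by rewrite invr0 mulr0 invr_ge0.
  by rewrite ler_pdivrMr ?lt0r ?d0 ?ler0n// mulrC.
by apply: lerXn2r; rewrite // nnegrE ?invr_ge0 ?divr_ge0 ?sumr_ge0.
Qed.

(** The sides of the box are [1 - t_i] when [t] is in the upper half and [t_i]
    otherwise; in both cases they add up to at most [d / 2], so that AM-GM
    bounds the volume. *)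
Lemma measure_decided_set t : cube t -> (mu (decided_set t) <= (2^-1 ^+ d)%:E)%E.
Proof.
move=> tc; have t01 i : 0 <= tnth t i <= 1 by have := tc i; rewrite in_itv.
rewrite /decided_set; case: ifPn => tH.
  rewrite (_ : _ `&` _ = [set x | forall i, tnth x i \in `[tnth t i, 1]]).
    rewrite measure_box => [|i]; last by have /andP[] := t01 i.
    rewrite lee_fin prod_le_half // => [i|].
      by rewrite subr_ge0; have /andP[] := t01 i.
    rewrite sumrB big_const_ord iter_addr addr0; move: tH; rewrite /upper_half.
    by set s := \sum_(i < d) _ => tH; lra.
  apply/seteqP; split=> [x [xc xt] i|x xt].
    by have := xc i; rewrite !in_itv/= => /andP[_ ->]; rewrite xt.
  split=> i; have := xt i; rewrite !in_itv/= => /andP[tx x1] //.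
  by rewrite x1 andbT (le_trans _ tx)//; have /andP[] := t01 i.
rewrite (_ : _ `&` _ = [set x | forall i, tnth x i \in `[0, tnth t i]]).
  rewrite (@measure_box (fun=> 0)) => [|i]; last by have /andP[] := t01 i.
  under eq_bigr do rewrite subr0.
  rewrite lee_fin prod_le_half // => [i|]; first by have /andP[] := t01 i.
  by move: tH; rewrite /upper_half -ltNge => /ltW.
apply/seteqP; split=> [x [xc xt] i|x xt].
  by have := xc i; rewrite !in_itv/= => /andP[-> _]; rewrite xt.
split=> i; have := xt i; rewrite !in_itv/= => /andP[x0 tx] //.
by rewrite x0 (le_trans tx)//; have /andP[] := t01 i.
Qed.

(** * Monotone indicators and adaptive information *)

Lemma monotone_indic A :
  (forall x y, tuple_le x y -> A x -> A y) -> monotone_class R d \1_A.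
Proof.
move=> upA; split=> [x _|j x y _ _ xy xyj].
  by rewrite indicE in_itv/=; case: (_ \in _); rewrite /= ?lexx ler01.
rewrite !indicE ler_nat; have [/set_mem xA|//] := boolP (x \in A).
rewrite mem_set//; apply: upA xA => i.
by have [->//|ij] := eqVneq i j; rewrite xy.
Qed.

Lemma INT_indic A : measurable A -> INT \1_A = fine (mu (A `&` cube)).
Proof.
by move=> mA; rewrite /INT /Rintegral integral_indic//; exact: measurable_cube.
Qed.

(** Adaptivity does not help to tell [f] from [g]: if they agree on the nodes
    chosen while running on [g], then the run on [f] chooses the same nodes. *)
Lemma alg_info_eq n (A : @algorithm R d n) (f g : euclid R d -> R) k :
  (forall j, (j < k)%N ->
     let t := alg_node A (alg_info A g j) in f t = g t) ->
  alg_info A f k = alg_info A g k.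
Proof.
elim: k => [//|k IH] fg /=.
by rewrite IH => [|j jk]; [rewrite fg | apply: fg; rewrite ltnW].
Qed.

(** * The fooling pair and its gap *)

Section Nodes.
Variables (n : nat) (t : nat -> euclid R d).

(** The indicators of [forced_up] and of the complement of [forced_down] are
    the smallest and the largest monotone functions with values in [0, 1]
    that agree with the indicator of the upper half on the nodes. *)
Definition forced_up : set (euclid R d) :=
  \bigcup_(k in [set k | (k < n)%N && upper_half (t k)]) up_set (t k).
Definition forced_down : set (euclid R d) :=
  \bigcup_(k in [set k | (k < n)%N && ~~ upper_half (t k)]) down_set (t k).

Lemma measurable_forced_up : measurable forced_up.
Proof. by apply: bigcup_measurable => k _; exact: measurable_up_set. Qed.

Lemma measurable_forced_down : measurable forced_down.
Proof. by apply: bigcup_measurable => k _; exact: measurable_down_set. Qed.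

Lemma forced_up_half x : forced_up x -> upper_half x.
Proof. by case=> k /andP[_ tk] /upper_half_le; exact. Qed.

Lemma forced_down_half x : forced_down x -> ~~ upper_half x.
Proof. by case=> k /andP[_ tk] xt; apply: contra tk; exact: upper_half_le. Qed.

Lemma lower_fooling_monotone : monotone_class R d \1_forced_up.
Proof.
apply: monotone_indic => x y xy [k kP tx]; exists k => // i.
exact: le_trans (tx i) (xy i).
Qed.

Lemma upper_fooling_monotone : monotone_class R d \1_(~` forced_down).
Proof.
apply: monotone_indic => x y xy; apply: contra_not => -[k kP ty].
by exists k => // i; exact: le_trans (xy i) (ty i).
Qed.

Lemma lower_fooling_node k : (k < n)%N ->
  \1_forced_up (t k) = (upper_half (t k))%:R :> R.
Proof.
move=> kn; rewrite indicE; congr (_%:R); congr nat_of_bool.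
apply/idP/idP => [/set_mem/forced_up_half//|tk].
by apply/mem_set; exists k; rewrite /= ?kn.
Qed.

Lemma upper_fooling_node k : (k < n)%N ->
  \1_(~` forced_down) (t k) = (upper_half (t k))%:R :> R.
Proof.
move=> kn; rewrite indicE in_setC; congr (_%:R); congr nat_of_bool.
apply/idP/idP => [|tk]; last by apply/negP => /set_mem/forced_down_half/negP.
apply: contraNT => tk; apply/mem_set; exists k => /=; first by rewrite kn.
by [].
Qed.

(** The two functions differ exactly outside [V], the union of the boxes
    decided by the nodes, and [V] has volume at most [n 2^-d]. *)
Lemma fooling_gap : (forall k, cube (t k)) ->
  1 - n%:R * 2^-1 ^+ d <= INT \1_(~` forced_down) - INT \1_forced_up.
Proof.
move=> tc.
have mC := measurable_cube.
have mU := measurable_forced_up; have mL := measurable_forced_down.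
pose V := \bigcup_(k in `I_n) decided_set (t k).
have mV : measurable V.
  by apply: bigcup_measurable => k _; exact: measurable_decided_set.
have finC E : measurable E -> E `<=` cube -> mu E \is a fin_num.
  move=> mE EC; rewrite ge0_fin_numE// (@le_lt_trans _ _ 1%E) ?ltry//.
  by rewrite -measure_cube le_measure ?inE.
have muV : (mu V <= (n%:R * 2^-1 ^+ d)%:E)%E.
  apply: (@le_trans _ _ (\sum_(k < n) mu (decided_set (t k)))%E).
    rewrite /V bigcup_mkord.
    apply: (Boole_inequality mu (A := fun k => decided_set (t k))) => k _.
    exact: measurable_decided_set.
  apply: (@le_trans _ _ (\sum_(k < n) (2^-1 ^+ d)%:E)%E).
    by apply: lee_sum => k _; exact: measure_decided_set.
  by rewrite sumEFin lee_fin sumr_const card_ord mulr_natl.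
have VC : V `<=` cube.
  by move=> x [k _ []].
have cubeD : (mu cube = mu V + mu (cube `\` V))%E.
  rewrite -measureU ?setDUK//; first exact: measurableD.
  exact: setDIK.
(* The left-hand sets are disjoint, and both avoid [forced_down]: the first
   because it lies in the upper half, the second because it avoids [V]. *)
have gap : (mu (forced_up `&` cube) + mu (cube `\` V) <=
            mu (~` forced_down `&` cube))%E.
  rewrite -measureU; [|exact: measurableI|exact: measurableD|].
    apply: le_measure; rewrite ?inE.
    - by apply: measurableU; [exact: measurableI|exact: measurableD].
    - by apply: measurableI => //; exact: measurableC.
    move=> x [[xU xC]|[xC xV]]; split=> // xL.
      by have := forced_down_half xL; rewrite forced_up_half.
    apply: xV; case: xL => k /andP[kn tk] xk.
    by exists k => //; split=> //; rewrite (negbTE tk).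
  apply/seteqP; split=> // x [[[k /andP[kn tk] xk] xC] [_ xV]]; apply: xV.
  by exists k => //; split=> //; rewrite tk.
rewrite !INT_indic//; last exact: measurableC.
move: muV cubeD gap; rewrite measure_cube.
have /fineK <- : mu V \is a fin_num by exact: finC.
have /fineK <- : mu (cube `\` V) \is a fin_num.
  by apply: finC; [exact: measurableD|exact: subDsetl].
have /fineK <- : mu (forced_up `&` cube) \is a fin_num.
  by apply: finC; [exact: measurableI|exact: subIsetr].
have /fineK <- : mu (~` forced_down `&` cube) \is a fin_num.
  by apply: finC; [apply: measurableI => //; exact: measurableC|exact: subIsetr].
rewrite -!EFinD !lee_fin /= => muV [] cubeD gap.
lra.
Qed.

End Nodes.

(** * Lower bounds for the error and the complexity *)

(** A single value [a] is returned on both fooling functions; it cannot be within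
    less than half the gap of both integrals. *)
Lemma worst_case_error_ge n (A : @algorithm R d n) :
  (((1 - n%:R * 2^-1 ^+ d) / 2)%:E <=
   worst_case_error (monotone_class R d) A)%E.
Proof.
pose g x : R := (upper_half x)%:R.
pose t k := alg_node A (alg_info A g k).
have lower_apply : alg_apply A \1_(forced_up n t) = alg_apply A g.
  congr (alg_phi A _); apply: alg_info_eq => k kn.
  exact: lower_fooling_node.
have upper_apply : alg_apply A \1_(~` forced_down n t) = alg_apply A g.
  congr (alg_phi A _); apply: alg_info_eq => k kn.
  exact: upper_fooling_node.
have gap := @fooling_gap n t (fun k => alg_node_cube _ _).
have lb f : monotone_class R d f ->
    ((`|INT f - alg_apply A f|)%:E <=
     worst_case_error (monotone_class R d) A)%E.
  by move=> fF; apply: ereal_sup_ubound; exists f.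
have := lb _ (lower_fooling_monotone n t); rewrite lower_apply.
have := lb _ (upper_fooling_monotone n t); rewrite upper_apply.
move: gap (alg_apply A g); set p := INT _; set q := INT _; set m := 1 - _.
move=> gap a.
have [pa up _|pa _] := leP (m / 2) `|p - a|.
  by apply: le_trans up; rewrite lee_fin.
apply: le_trans; rewrite lee_fin.
have := ler_norm (p - a); have := ler_norm (- (q - a)); rewrite normrN.
lra.
Qed.

Lemma info_complexity_ge (e : R) :
  ((2 ^+ d * (1 - 2 * e))%:E <= info_complexity (monotone_class R d) e)%E.
Proof.
apply: le_ereal_inf_tmp => _ [n /= ne <-]; rewrite lee_fin.
have : ((((1 - n%:R * 2^-1 ^+ d) / 2)%:E : \bar R) <= e%:E)%E.
  apply: le_trans ne; apply: le_ereal_inf_tmp => _ [A _ <-].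
  exact: worst_case_error_ge.
rewrite lee_fin => {}ne.
have p2 : (0 : R) < 2 ^+ d by rewrite exprn_gt0.
rewrite mulrC -ler_pdivlMr// -exprVn; lra.
Qed.

End Fooling.

Theorem theorem1 (R : realType) :
  (forall (e : R) (d : nat), 0 < e -> e < 1 / 2 -> (0 < d)%N ->
     ((2 ^+ d * (1 - 2 * e))%:E <= info_complexity (monotone_class R d) e)%E) /\
  curse_of_dimensionality (monotone_class R).
Proof.
split=> [e d _ _ _|]; first exact: info_complexity_ge.
exists (1 / 4), (1 / 2), 2; split; try lra.
move=> d _; apply: le_trans (info_complexity_ge (1 / 4)).
rewrite lee_fin mulrC; apply: ler_wpM2l; last by lra.
by rewrite exprn_ge0.
Qed.
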